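(* Let $e>1$ and $n\ge1$ be integers, $\zeta=\exp(2\pi\sqrt{-1}/e)$, and $G=G(e,1,n)$. For $1\le s,t\le e-1$, $a,b\in\mathbb{Z}/e\mathbb{Z}$ and distinct $1\le i,j,k\le n$ (in (4), $l$ is also an index in $\{1,\dots,n\}$), the following relations hold in the algebra $\mathcal{B}(M_G)$: (1) $[H_{ij}(a)][H_{jk}(b)]-\zeta^{a}[H_{ik}(a+b)][H_{ij}(a)]-[H_{jk}(b)][H_{ik}(a+b)]=0$; (2) $$\sum_{p=1}^{e_H/d(e_H,2(a-b))}\zeta^{2p(a-b)}[H_{ij}(a+2p(a-b))][H_{ij}(b+2p(a-b))]=\sum_{q=1}^{e_H/d(e_H,2(a-b))}\zeta^{(2q-1)(a-b)}[H_{ij}(b+2q(a-b))][H_{ij}(a+2(q-1)(a-b))],$$ where $H=H_{ij}(a)$; (3) $[H_{ij}(a)][H_i;s]-\zeta^{-a}[H_j;s][H_{ij}(a)]+\zeta^{-a}[H_{ij}(a-s)][H_j;s]-\zeta^{-s}[H_i;s][H_{ij}(a-s)]=0$; (4) $[H_{ij}(a)][H_{kl}(b)]=[H_{kl}(b)][H_{ij}(a)]$ if $\{i,j\}\cap\{k,l\}=\emptyset$; (5) $[H_i;s][H_j;t]=[H_j;t][H_i;s]$; (6) $[H_{ij}(a)][H_k;s]=[H_k;s][H_{ij}(a)]$ if $k\ne i,j$.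
   Context: The group. $V=\bigoplus_{i=1}^n\mathbb{C}\epsilon_i$ is an $n$-dimensional hermitian vector space with orthonormal basis $(\epsilon_i)$ and coordinate system $(x_i)$ with respect to this basis. $G=G(e,1,n)\subset GL(V)$ is the complex reflection group of monomial matrices whose nonzero entries are $e$-th roots of unity. Its reflection hyperplanes are $H_{ij}(a):x_i-\zeta^a x_j=0$ ($1\le i<j\le n$, $a\in\mathbb{Z}/e\mathbb{Z}$) and $H_i:x_i=0$ ($1\le i\le n$). Let $\mathcal{A}$ be the set of these hyperplanes. For $H\in\mathcal{A}$ the stabilizer $G_H\subset G$ of $H$ (the elements fixing $H$ pointwise) is a cyclic group of order $e_H$, and $g_H\in G_H$ is the unique element with $\det(g_H;V)=\exp(2\pi\sqrt{-1}/e_H)$. The normal vectors are chosen as $v_{H_{ij}(a)}=\epsilon_i-\zeta^{-a}\epsilon_j$ ($i<j$) and $v_{H_i}=\epsilon_i$. The constants $\lambda(g,H)\in\mathbb{C}^\times$ are defined by $g(v_H)=\lambda(g,H)v_{gH}$. $d(N_1,N_2)>0$ denotes the greatest common divisor of the integers $N_1$ and $N_2$. The module $M_G$. $M_G$ is the $\mathbb{C}$-vector space with basis the symbols $[H;k]$, $H\in\mathcal{A}$, $1\le k\le e_H-1$, with $G$-action $g([H;k])=\overline{\lambda(g,H)}^{\,-1}[gH;k]$ and $G$-grading $\deg_G([H;k])=g_H^k$. It is a Yetter-Drinfeld module over $G$, with braiding $\Psi:M_G\otimes M_G\to M_G\otimes M_G$, $\Psi(x\otimes y)=g(y)\otimes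 x$ for $x$ of $G$-degree $g$. Write $[H_{ij}(a)]:=[H_{ij}(a);1]$ for $i<j$, and put $[H_{ji}(a)]:=-\zeta^{a}[H_{ij}(-a)]$. The algebra $\mathcal{B}(M_G)$ is generated by the symbols $[H_{ij}(a)]$, $a\in\mathbb{Z}/e\mathbb{Z}$, and $[H_i;s]$, $1\le s\le e-1$. Nichols-Woronowicz algebra. For a braided vector space $M$ with braiding $\Psi$, let $\Psi_i$ be $\Psi$ acting on the $i$-th and $(i+1)$-st factors of $M^{\otimes m}$. For $w\in S_m$ with reduced expression $w=s_{i_1}\cdots s_{i_l}$ ($s_i=(i,i+1)$) put $\Psi_w=\Psi_{i_1}\cdots\Psi_{i_l}$ (independent of the reduced expression), and $\sigma_m=\sum_{w\in S_m}\Psi_w$. Then $\mathcal{B}(M)=\bigoplus_{m\ge0}M^{\otimes m}/\mathrm{Ker}(\sigma_m)$, an algebra that is a quotient of the tensor algebra of $M$.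
   Formalization: In (2) the right-hand sum has the opposite sign and both sums run to e/d(e,2(a-b)) instead of e_H/d(e_H,2(a-b)); for i<j the convention is [H_ji(a)] = -ζ^{-a}[H_ij(-a)] instead of -ζ^{a}[H_ij(-a)]; as printed, (2) fails for a≠b, and (1), (3) fail in general for e>2. *)

(* Defs.v *)
From HB Require Import structures.
From mathcomp Require Import all_boot all_order all_fingroup all_algebra.
From mathcomp Require Import generic_quotient ring_quotient.
From mathcomp Require Import finmap complex monalg.
From mathcomp Require Import boolp classical_sets cardinality reals trigo.

Set Implicit Arguments.
Unset Strict Implicit.
Unset Printing Implicit Defensive.

Import Order.TTheory GRing.Theory Num.Theory.
Local Open Scope ring_scope.
Local Open Scope quotient_scope.

(* M is the vector space with basis I, and the braiding is given on the basis *)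
(* by Psi (x (x) y) = \sum_(u, v) Psi x y (u, v) *: (u (x) v).                *)
Section NicholsWoronowicz.
Variables (C : fieldType) (I : finType) (Psi : I -> I -> {ffun I * I -> C}).

(* The tensor algebra of M: words in I form a basis, and the words of length  *)
(* m span its component of degree m.                                          *)
Local Notation T := {malg C[{fmonom I}]}.

Definition word (s : seq I) : T := << FMonom s >>.

Definition tensor_of (v : {ffun I -> C}) : T := \sum_x v x *: word [:: x].

Definition linear_ext (h : seq I -> T) (x : T) : T :=
  \sum_(s <- msupp x) mcoeff s x *: h s.

(* The braiding acting on the factors numbered k and k + 1, counted from 0.   *)
Definition braid_word (k : nat) (s : seq I) : T :=
  if drop k s is x :: y :: s' then
    \sum_(p : I * I) Psi x y p *: word (take k s ++ [:: p.1, p.2 & s'])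
  else word s.

Definition braid (k : nat) : T -> T := linear_ext (braid_word k).

(* The list (i_1, i_1 + 1), ..., (i_l, i_l + 1) is an expression of w.        *)
Definition expression m (w : 'S_m) (l : seq ('I_m * 'I_m)) : Prop :=
  all (fun p : 'I_m * 'I_m => p.2 == p.1.+1 :> nat) l /\
  w = (\prod_(p <- l) tperm p.1 p.2)%g.

Definition reduced_expression m (w : 'S_m) (l : seq ('I_m * 'I_m)) : Prop :=
  expression w l /\ forall l', expression w l' -> (size l <= size l')%N.

(* Psi_w = Psi_(i_1) \o ... \o Psi_(i_l). Products in 'S_m are composed from  *)
(* left to right; the opposite convention would exchange Psi_w and            *)
(* Psi_(w^-1), which does not affect the sum over w below.                    *)
Definition braid_perm m (w : 'S_m) (x : T) : T :=
  foldr (fun p : 'I_m * 'I_m => braid p.1) x (xget [::] [set l | reduced_expression w l]).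

(* sigma is the direct sum of the sigma_m, so that its kernel is the direct   *)
(* sum of the Ker sigma_m.                                                    *)
Definition sigma : T -> T :=
  linear_ext (fun s => \sum_(w : 'S_(size s)) braid_perm w (word s)).

Definition ker_sigma : {pred T} := [pred x | sigma x == 0].

Lemma linear_extEw h (d : {fset {fmonom I}}) x : (msupp x `<=` d)%fset ->
  linear_ext h x = \sum_(s <- d) mcoeff s x *: h s.
Proof.
move=> le; rewrite /linear_ext; apply/esym.
rewrite (big_fset_incl _ le) // => s _ /mcoeff_outdom ->.
by rewrite scale0r.
Qed.

Lemma linear_ext_additive h x y :
  linear_ext h (x - y) = linear_ext h x - linear_ext h y.
Proof.
pose d := (msupp (x - y) `|` (msupp x `|` msupp y))%fset.
rewrite (@linear_extEw h d) ?fsubsetUl //.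
rewrite (@linear_extEw h d x); last by rewrite /d fsetUCA fsubsetUl.
rewrite (@linear_extEw h d y); last by rewrite /d fsetUA fsubsetUr.
by rewrite -sumrB; apply: eq_bigr => s _; rewrite mcoeffB scalerBl.
Qed.

Fact ker_sigma_zmod_closed : zmod_closed ker_sigma.
Proof.
split=> [|x y]; rewrite !inE /sigma.
  by rewrite /linear_ext msupp0 big_seq_fset0.
by move=> /eqP hx /eqP hy; rewrite linear_ext_additive hx hy subrr.
Qed.

HB.instance Definition _ :=
  GRing.isZmodClosed.Build T ker_sigma ker_sigma_zmod_closed.

(* The kernel of sigma is a two-sided ideal when Psi satisfies the braid      *)
(* equation, and the product of B(M) is then induced by that of the tensor    *)
(* algebra: a polynomial relation between the classes of elements of T holds  *)
(* in B(M) when the same polynomial expression in T has class 0.              *)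
Definition nichols := Quotient.quot ker_sigma.

Definition nichols_class (x : T) : nichols := \pi_nichols x.

End NicholsWoronowicz.

(* G = G(e, 1, n), acting on column vectors over R[i]. The parameter of a     *)
(* hyperplane H_ij(a) is in 'Z_e, which is Z/e only when e > 1.               *)
Section ReflectionGroup.
Variables (R : realType) (e n : nat).
Local Notation C := R[i].
Local Notation V := 'cV[C]_n.

Definition expi (N : nat) : C :=
  (cos (2 * pi / N%:R) +i* sin (2 * pi / N%:R))%C.

Definition zeta_pow (a : 'Z_e) : C := expi e ^+ a.

Definition monomial (g : 'M[C]_n) : Prop :=
  (forall i, exists! j, g i j != 0) /\ (forall j, exists! i, g i j != 0).

Definition G_e1n : set 'M[C]_n :=
  [set g | monomial g /\ forall i j, g i j != 0 -> g i j ^+ e = 1].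

(* inl (i, j, a) stands for H_ij(a), inr i for H_i. Only the inl (i, j, a)    *)
(* with i < j are kept in the arrangement.                                    *)
Definition hyp_index : finType := ('I_n * 'I_n * 'Z_e + 'I_n)%type.

Definition hyp_set (H : hyp_index) : set V :=
  match H with
  | inl (i, j, a) => [set x | x i 0 - zeta_pow a * x j 0 = 0]
  | inr i => [set x | x i 0 = 0]
  end.

Definition hyp_normal (H : hyp_index) : V :=
  match H with
  | inl (i, j, a) => delta_mx i 0 - zeta_pow (- a) *: delta_mx j 0
  | inr i => delta_mx i 0
  end.

Definition in_arrangement (H : hyp_index) : bool :=
  if H is inl (i, j, _) then (i < j)%N else true.

Definition arrangement : finType := {H : hyp_index | in_arrangement H}.

Definition stabilizer (H : arrangement) : set 'M[C]_n :=
  [set g | G_e1n g /\ forall x, hyp_set (val H) x -> g *m x = x].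

Definition stab_order (H : arrangement) : nat :=
  #|` fset_set (stabilizer H)|.

Definition reflection (H : arrangement) : 'M[C]_n :=
  xget 1%:M [set g | stabilizer H g /\ \det g = expi (stab_order H)].

Definition hyp_act (g : 'M[C]_n) (H : arrangement) : arrangement :=
  xget H [set H' | hyp_set (val H') = (mulmx g @` hyp_set (val H))%classic].

Definition lambda (g : 'M[C]_n) (H : arrangement) : C :=
  xget 0 [set c | g *m hyp_normal (val H) =
                  c *: hyp_normal (val (hyp_act g H))].

(* The symbol [H; k] is the pair of H and k - 1.                              *)
Definition symbol : finType := {H : arrangement & 'I_(stab_order H).-1}.

Definition symbol_exp (x : symbol) : nat := (tagged x).+1.

Definition M_G : Type := {ffun symbol -> C}.

(* [H; k] as an element of M_G; it is 0 unless H is in the arrangement and    *)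
(* 1 <= k <= e_H - 1.                                                         *)
Definition basis_vec (H : hyp_index) (k : nat) : M_G :=
  [ffun x : symbol => ((val (tag x) == H) && (symbol_exp x == k))%:R].

Definition act_symbol (g : 'M[C]_n) (x : symbol) : M_G :=
  [ffun z => (conjc (lambda g (tag x)))^-1 *
             basis_vec (val (hyp_act g (tag x))) (symbol_exp x) z].

Definition deg_symbol (x : symbol) : 'M[C]_n :=
  reflection (tag x) ^+ symbol_exp x.

(* Psi (x (x) y) = deg(x)(y) (x) x.                                           *)
Definition braiding_G (x y : symbol) : {ffun symbol * symbol -> C} :=
  [ffun p => if p.2 == x then act_symbol (deg_symbol x) y p.1 else 0].

Local Notation T := {malg C[{fmonom symbol}]}.

Definition B_MG := nichols braiding_G.

Definition cls (x : T) : B_MG := nichols_class braiding_G x.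

Definition brk1 (i : 'I_n) (s : nat) : T := tensor_of (basis_vec (inr i) s).

(* For i > j the coefficient is the one given by the normal vectors,          *)
(* e_i - zeta^(-a) e_j = - zeta^(-a) (e_j - zeta^a e_i), on which G acts as   *)
(* it does on the symbols, since |lambda(g, H)| = 1. With - zeta^a instead,   *)
(* the three-term relations between the [H_ij(a)] fail for e > 2.             *)
Definition brk2 (i j : 'I_n) (a : 'Z_e) : T :=
  if (i < j)%N then tensor_of (basis_vec (inl (i, j, a)) 1)
  else - zeta_pow (- a) *: tensor_of (basis_vec (inl (j, i, - a)) 1).

End ReflectionGroup.

(* Main.v *)
Require Import Defs.
From mathcomp Require Import all_boot all_order all_fingroup all_algebra.
From mathcomp Require Import generic_quotient ring_quotient.
From mathcomp Require Import finmap complex monalg.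
From mathcomp Require Import boolp classical_sets cardinality reals trigo.
From mathcomp Require Import ring.

Set Implicit Arguments.
Unset Strict Implicit.
Unset Printing Implicit Defensive.

Import Order.TTheory GRing.Theory Num.Theory.
Local Open Scope ring_scope.

(* All the relations are quadratic and sigma_2 = 1 + Psi, so that each of     *)
(* them amounts to computing Psi on products of two generators. A monomial    *)
(* matrix g : e_i |-> zeta^(d i) e_(s i) sends [H_ij(a)] to                   *)
(* zeta^(d i) [H_(s i)(s j)(a + d i - d j)] and [H_i; k] to                   *)
(* zeta^(d i) [H_(s i); k], for all i != j provided [H_ji(a)] is the multiple *)
(* of [H_ij(- a)] given by the normal vectors. The degree of [H_ij(a)] is the *)
(* reflection with s = (i j), d i = - a and d j = a, and that of [H_i; k] is  *)
(* the diagonal matrix with d i = k. Up to scalars, Psi then permutes         *)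
(* cyclically the terms of each relation, and 1 + Psi kills their sum.        *)

(** Move all terms of a relation to one side and call them, with their signs and coefficients, u_0,
    ..., u_(r-1). In every case Psi u_m = - u_(m+1) with indices modulo r, so (1 + Psi) u_m = u_m -
    u_(m+1) and the sum over the cycle telescopes to 0. The length r is 2 for the commutations, 3
    for the relation on H_ij, H_jk, H_ik, 4 for the one mixing H_ij with H_i and H_j, and 2 N for
    two hyperplanes on the same pair i, j, where N = e / gcd(e, 2 (a - b)). What has to be checked
    is that the roots of unity produced by Psi cancel around the cycle.

    [sigma_word2] gives 1 + Psi. To evaluate Psi, every choice made by [xget] must be identified:
    [stabilizer_line] and [stabilizer_coord] determine e_H and g_H, while [hyp_act_eq] and
    [lambda_eq] determine the action on the symbols. [sigma_line] and [sigma_coord] combine these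
    into the value of 1 + Psi on a product of two generators. The telescoping is pure linear
    algebra: [two_terms], [three_terms], [four_terms] and [telescope_odd_even]. *)

Section SecondSymmetrizer.
Variables (C : fieldType) (I : finType) (Psi : I -> I -> {ffun I * I -> C}).
Local Notation T := {malg C[{fmonom I}]}.
Implicit Types (x y : T) (h : seq I -> T).

Lemma linear_ext0 h : linear_ext h 0 = 0.
Proof. by rewrite /linear_ext msupp0 big_seq_fset0. Qed.

Lemma linear_extN h x : linear_ext h (- x) = - linear_ext h x.
Proof. by rewrite -(sub0r x) linear_ext_additive linear_ext0 sub0r. Qed.

Lemma linear_extD h x y :
  linear_ext h (x + y) = linear_ext h x + linear_ext h y.
Proof. by rewrite -{1}(opprK y) linear_ext_additive linear_extN opprK. Qed.

Lemma linear_extZ h (c : C) x : linear_ext h (c *: x) = c *: linear_ext h x.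
Proof.
rewrite (linear_extEw h (msuppZ_le c x)) scaler_sumr.
by apply: eq_bigr => s _; rewrite mcoeffZ scalerA.
Qed.

Lemma linear_ext_word h (s : seq I) : linear_ext h (word C s) = h s.
Proof.
by rewrite /linear_ext /word msuppU oner_eq0 big_seq_fset1 mcoeffUU scale1r.
Qed.

Lemma big_S2 (F : 'S_2 -> T) :
  \sum_(w : 'S_2) F w = F 1%g + F (tperm ord0 ord_max).
Proof.
have t_neq1 : tperm ord0 ord_max != 1%g :> 'S_2.
  by apply/eqP=> /permP /(_ ord0); rewrite tpermL perm1.
rewrite (bigD1 1%g) //= (bigD1 (tperm ord0 ord_max)) //= big1 ?addr0 // => w.
case/andP=> w1 wt; suff : w \in [:: 1%g; tperm ord0 ord_max].
  by rewrite !inE (negPf w1) (negPf wt).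
have ord2 (i : 'I_2) : i = ord0 \/ i = ord_max.
  by case: i => [[|[|//]] ?]; [left|right]; apply: val_inj.
have winj := @perm_inj _ w; rewrite !inE; apply/orP.
case: (ord2 (w ord0)) => w0; [left|right]; apply/eqP/permP => i.
  rewrite perm1; case: (ord2 i) => -> //; case: (ord2 (w ord_max)) => // wm.
  by have := winj ord0 ord_max; rewrite w0 wm => /(_ erefl).
case: (ord2 i) => ->; rewrite ?tpermL ?tpermR //.
case: (ord2 (w ord_max)) => // wm.
by have := winj ord0 ord_max; rewrite w0 wm => /(_ erefl).
Qed.

(** The empty list is an expression of 1, so by minimality it is the only reduced one; it is also
    the default of [xget]. *)
Lemma braid_perm1 x : braid_perm Psi (1%g : 'S_2) x = x.
Proof.
rewrite /braid_perm; case: xgetP => [l _ [_ lmin]|//].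
have /lmin : expression (1%g : 'S_2) [::] by split; rewrite ?big_nil.
by rewrite leqn0 size_eq0 => /eqP ->.
Qed.

(** A reduced expression has length one, and a pair (k, k + 1) in 'I_2 can only have k = 0. *)
Lemma braid_perm_tperm x :
  braid_perm Psi (tperm ord0 ord_max : 'S_2) x = braid Psi 0 x.
Proof.
have t_neq1 : tperm ord0 ord_max <> 1%g :> 'S_2.
  by move=> /permP /(_ ord0); rewrite tpermL perm1.
have te : expression (tperm ord0 ord_max : 'S_2) [:: (ord0, ord_max)].
  by split; rewrite ?big_seq1.
rewrite /braid_perm; case: xgetP => [l _ [le lmin]|nle].
  have := lmin _ te; rewrite /= => {lmin}.
  case: l le => [[_]|p l [/= /andP[/eqP pe _] _]]; first by rewrite big_nil.
  rewrite ltnS leqn0 size_eq0 => /eqP -> /=.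
  have -> // : p.1 = 0%N :> nat.
  by have := ltn_ord p.2; rewrite pe ltnS ltnS leqn0 => /eqP.
(* The default [[::]] would give the identity instead of Psi, so a reduced expression has to be
   exhibited. *)
exfalso; apply: (nle [:: (ord0, ord_max)]); split; first exact: te.
case=> [[_]|p l _]; first by rewrite big_nil.
exact: ltn0Sn.
Qed.

Lemma sigma_word2 (a b : I) :
  sigma Psi (word C [:: a; b]) =
  word C [:: a; b] + \sum_(p : I * I) Psi a b p *: word C [:: p.1; p.2].
Proof.
rewrite /sigma linear_ext_word big_S2 braid_perm1 braid_perm_tperm.
by rewrite /braid linear_ext_word /braid_word.
Qed.

Lemma word_mul (s1 s2 : seq I) : word C s1 * word C s2 = word C (s1 ++ s2).
Proof. by rewrite /word malgM_def fgmulUU mulr1 [mmul _ _]/mmul /= fmmulE. Qed.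

Lemma tensor_of_delta (x : I) :
  tensor_of [ffun y => (y == x)%:R] = word C [:: x].
Proof.
rewrite /tensor_of (bigD1 x) //= ffunE eqxx scale1r big1 ?addr0 // => y yx.
by rewrite ffunE (negPf yx) scale0r.
Qed.

Lemma tensor_ofZ (c : C) (v : {ffun I -> C}) :
  tensor_of [ffun x => c * v x] = c *: tensor_of v.
Proof.
by rewrite /tensor_of scaler_sumr; apply: eq_bigr => x _; rewrite ffunE scalerA.
Qed.

(** The right-hand side has the shape of [braiding_G], which is supported on the pairs whose second
    component is the symbol x that moves to the right. *)
Lemma tensor_of_mul_word (v : {ffun I -> C}) (x : I) :
  tensor_of v * word C [:: x] =
  \sum_(p : I * I) (if p.2 == x then v p.1 else 0) *: word C [:: p.1; p.2].
Proof.
rewrite -(pair_bigA _ (fun y u : I => (if u == x then v y else 0) *: word C [:: y; u])) /=.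
rewrite /tensor_of mulr_suml; apply: eq_bigr => y _.
rewrite (bigD1 x) //= eqxx big1 => [|u /negPf->]; last by rewrite scale0r.
by rewrite addr0 -scalerAl word_mul.
Qed.

(* The library makes {malg C[K]} an algebra only for commutative monomials.   *)
Lemma malg_scalerAr (c : C) x y : x * (c *: y) = c *: (x * y).
Proof.
apply/malgP => k; rewrite mcoeffZ (mcoeffMlw _ (fsubset_refl _) (msuppZ_le c y)).
rewrite mcoeffMl mulr_sumr; apply: eq_bigr => k1 _.
rewrite mulr_sumr; apply: eq_bigr => k2 _.
by rewrite mcoeffZ mulrCA mulrnAr.
Qed.

(** Carries the scalar [line_coef] of a left factor x through the formula for 1 + Psi, where x moves
    from the left to the right. *)
Lemma scaler_braid (c u : C) x y w :
  c *: (x * y + u *: (w * x)) = (c *: x) * y + u *: (w * (c *: x)).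
Proof. by rewrite malg_scalerAr scalerDr scalerAl !scalerA [c * u]mulrC. Qed.

Lemma eq_nichols_class x y : sigma Psi (x - y) = 0 ->
  nichols_class Psi x = nichols_class Psi y.
Proof. by move=> s0; apply/eqP; rewrite /nichols_class -Quotient.idealrBE inE s0. Qed.

Lemma nichols_class_eq0 x : sigma Psi x = 0 -> nichols_class Psi x = 0.
Proof.
move=> s0; transitivity (nichols_class Psi 0); first by apply: eq_nichols_class; rewrite subr0.
by rewrite /nichols_class pi_zeror.
Qed.

Lemma nichols_class_eqN x y : sigma Psi (x + y) = 0 ->
  nichols_class Psi x = - nichols_class Psi y.
Proof.
move=> s0; transitivity (nichols_class Psi (- y)).
  by apply: eq_nichols_class; rewrite opprK.
by rewrite /nichols_class pi_oppr.
Qed.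

End SecondSymmetrizer.

(** * Roots of unity in R[i] *)

Section RootsOfUnity.
Variables (R : realType) (e : nat).
Hypothesis e_gt1 : (1 < e)%N.
Local Notation C := R[i].
Local Notation z := (@zeta_pow R e).

Lemma expi_exp N m : expi R N ^+ m =
  (cos (m%:R * (2 * pi / N%:R)) +i* sin (m%:R * (2 * pi / N%:R)))%C.
Proof.
elim: m => [|m IHm]; first by rewrite mul0r cos0 sin0.
rewrite exprS IHm /expi; set t := 2 * pi / N%:R.
have -> : m.+1%:R * t = t + m%:R * t by rewrite -add1n natrD mulrDl mul1r.
by rewrite cosD sinD; congr Complex; rewrite // addrC.
Qed.

(** By cos x = 1 - 2 sin^2 (x / 2), where x / 2 lies strictly between 0 and pi. *)
Lemma cos_neq1 (x : R) : 0 < x < 2 * pi -> cos x != 1.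
Proof.
case/andP=> x0 x2; pose y := x / 2.
have xE : x = y *+ 2 by rewrite -mulr_natr divfK // pnatr_eq0.
have sy : 0 < sin y.
  by apply: sin_gt0_pi; rewrite divr_gt0 //= ltr_pdivrMr // [pi * 2]mulrC.
rewrite xE cos_mulr2n cos2sin2 lt_eqF //.
have -> : (1 - sin y ^+ 2) *+ 2 - 1 = 1 - (sin y ^+ 2) *+ 2 by ring.
by rewrite gtrDl oppr_lt0 pmulrn_lgt0 // exprn_gt0.
Qed.

(** The order m divides N. If m < N, the angle 2 pi m / N lies strictly between 0 and 2 pi, yet its
    cosine is 1. *)
Lemma expi_prim N : (0 < N)%N -> N.-primitive_root (expi R N).
Proof.
move=> N0; have NR : (N%:R : R) != 0 by rewrite pnatr_eq0 -lt0n.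
have zN : expi R N ^+ N = 1.
  by rewrite expi_exp mulrC divfK // [2 * _]mulr_natl cos2pi sin2pi.
have [m zm mN] := prim_order_exists N0 zN.
suff eNm : m = N by rewrite eNm in zm.
apply/eqP; rewrite eqn_leq (dvdn_leq N0 mN) /= leqNgt; apply/negP => mltN.
have := prim_expr_order zm; rewrite expi_exp => /eqP; rewrite eq_complex /=.
case/andP=> /eqP cm _; have /eqP := cm; apply/negP; apply: cos_neq1.
rewrite mulr_gt0 ?divr_gt0 ?mulr_gt0 ?pi_gt0 ?ltr0n ?(prim_order_gt0 zm) //=.
rewrite mulrCA gtr_pMr ?mulr_gt0 ?pi_gt0 //.
by rewrite ltr_pdivrMr ?ltr0n // mul1r ltr_nat.
Qed.

Lemma expi_neq0 N : expi R N != 0.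
Proof.
apply/eqP=> z0; case: N z0 => [|N] z0.
  (* For N = 0 the inverse of 0 is 0, so the angle is 0 and [expi] takes the value 1. *)
  move/eqP: z0; rewrite /expi invr0 mulr0 cos0 sin0 eq_complex /= eqxx andbT.
  by rewrite oner_eq0.
have := prim_expr_order (expi_prim (ltn0Sn N)).
by rewrite z0 expr0n /= => /eqP; rewrite eq_sym oner_eq0.
Qed.

Lemma conjc_expi N : conjc (expi R N) = (expi R N)^-1.
Proof.
apply: (mulfI (expi_neq0 N)); rewrite divff ?expi_neq0 //.
rewrite /expi /conjc /=; apply/eqP; rewrite eq_complex /= mulrN opprK.
by rewrite -!expr2 cos2Dsin2 mulrN mulrC addNr !eqxx.
Qed.

Lemma expi2 : expi R 2 = -1.
Proof.
have z2 := expi_prim (ltn0Sn 1); have := prim_expr_order z2.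
move/eqP; rewrite sqrf_eq1 => /orP[/eqP z1|/eqP//].
by move: z2; rewrite z1 => /prim_order_dvd /(_ 1%N); rewrite eqxx.
Qed.

Let zP : e.-primitive_root (expi R e).
Proof. by apply: expi_prim; apply: ltnW. Qed.

Lemma zeta_pow_nat m : z m%:R = expi R e ^+ m.
Proof.
by rewrite /zeta_pow val_Zp_nat // (prim_expr_mod zP).
Qed.

Lemma zeta_powD (a b : 'Z_e) : z (a + b) = z a * z b.
Proof.
by rewrite -[a]natr_Zp -[b]natr_Zp -natrD !zeta_pow_nat exprD.
Qed.

Lemma zeta_pow0 : z 0 = 1.
Proof. by rewrite /zeta_pow expr0. Qed.

Lemma zeta_pow_neq0 (a : 'Z_e) : z a != 0.
Proof. by rewrite expf_neq0 ?expi_neq0. Qed.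

Lemma zeta_powN (a : 'Z_e) : z (- a) = (z a)^-1.
Proof.
apply: (mulfI (zeta_pow_neq0 a)).
by rewrite -zeta_powD subrr zeta_pow0 divff ?zeta_pow_neq0.
Qed.

Lemma conjc_zeta_pow (a : 'Z_e) : conjc (z a) = (z a)^-1.
Proof. by rewrite /zeta_pow -exprVn -conjc_expi rmorphXn. Qed.

Lemma zeta_pow_inj : injective z.
Proof.
move=> a b /eqP; rewrite /zeta_pow (eq_prim_root_expr zP) => /eqP ab.
have lt_e (x : 'Z_e) : (x < e)%N by rewrite -[X in (_ < X)%N](Zp_cast e_gt1).
by apply: val_inj; rewrite /= -(modn_small (lt_e a)) ab modn_small.
Qed.

Lemma zeta_pow_eE (a : 'Z_e) : z a ^+ e = 1.
Proof. by rewrite /zeta_pow exprAC (prim_expr_order zP) expr1n. Qed.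

Lemma zeta_powP (x : C) : x ^+ e = 1 -> exists a : 'Z_e, x = z a.
Proof.
case/(prim_rootP zP) => i ->; exists i%:R.
by rewrite zeta_pow_nat.
Qed.

End RootsOfUnity.

(** * Monomial matrices and their action on hyperplanes *)

Section MonomialMatrices.
Variables (R : realType) (e n : nat).
Hypothesis e_gt1 : (1 < e)%N.
Local Notation C := R[i].
Local Notation V := 'cV[C]_n.
Local Notation z := (@zeta_pow R e).
Local Notation delta i := (delta_mx i 0 : V).
Local Notation hyp_set := (@hyp_set R e n).
Implicit Types (s : 'S_n) (d : 'I_n -> 'Z_e) (a b : 'Z_e) (i j k l m : 'I_n).

Definition monomial_mx s d : 'M[C]_n :=
  \matrix_(k, l) (if k == s l then z (d l) else 0).

Lemma monomial_mx_mulE s d (x : V) i :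
  (monomial_mx s d *m x) (s i) 0 = z (d i) * x i 0.
Proof.
rewrite mxE (bigD1 i) //= !mxE eqxx big1 ?addr0 // => k ki.
by rewrite mxE (inj_eq perm_inj) eq_sym (negPf ki) mul0r.
Qed.

Lemma monomial_mx_delta s d i :
  monomial_mx s d *m delta i = z (d i) *: delta (s i).
Proof.
apply/colP => k; rewrite -[k](permKV s) monomial_mx_mulE !mxE !andbT.
rewrite (inj_eq perm_inj).
by case: eqP => [->|_]; rewrite ?mulr1 ?mulr0.
Qed.

Lemma eq_mx_delta (A B : 'M[C]_n) :
  (forall i, A *m delta i = B *m delta i) -> A = B.
Proof.
move=> AB; apply/matrixP => i j.
by have := congr1 (fun v : V => v i 0) (AB j); rewrite -!colE !mxE.
Qed.

(** Permutations are composed from left to right, hence the reversed order on the right-hand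
    side. *)
Lemma monomial_mx_mul s d s' d' :
  monomial_mx s' d' *m monomial_mx s d =
  monomial_mx (s * s') (fun i => d i + d' (s i)).
Proof.
apply: eq_mx_delta => i; rewrite -mulmxA !monomial_mx_delta -scalemxAr.
by rewrite monomial_mx_delta scalerA permM zeta_powD.
Qed.

Lemma monomial_mx1 : monomial_mx 1 (fun=> 0) = 1%:M.
Proof.
apply: eq_mx_delta => i.
by rewrite monomial_mx_delta perm1 zeta_pow0 scale1r mul1mx.
Qed.

Lemma monomial_mx1X d (p : nat) :
  monomial_mx 1 d ^+ p = monomial_mx 1 (fun i => d i *+ p).
Proof.
elim: p => [|p IHp]; first exact: esym monomial_mx1.
rewrite exprS IHp [_ * _]monomial_mx_mul mulg1; apply: eq_mx_delta => i.
by rewrite !monomial_mx_delta perm1 mulrS addrC.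
Qed.

Lemma monomial_mxP s d : G_e1n e (monomial_mx s d).
Proof.
split; last first.
  by move=> i j; rewrite mxE; case: ifP => [_ _|_ /eqP//]; exact: zeta_pow_eE.
split=> [i|j].
  exists (s^-1 i)%g; split=> [|j]; first by rewrite mxE permKV eqxx zeta_pow_neq0.
  by rewrite mxE; case: ifP => [/eqP ->|_ /eqP//]; rewrite permK.
exists (s j); split=> [|i]; first by rewrite mxE eqxx zeta_pow_neq0.
by rewrite mxE; case: ifP => [/eqP ->|_ /eqP//].
Qed.

(** s j is the row of the only nonzero entry of column j, and s is injective because each row has
    only one such entry. *)
Lemma G_e1nP (g : 'M[C]_n) : G_e1n e g -> exists s d, g = monomial_mx s d.
Proof.
case=> -[grow gcol] ge.
have /boolp.choice[f fP] : forall j, exists k, forall i, g i j != 0 <-> i = k.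
  by move=> j; have [k [kj ku]] := gcol j; exists k => i; split=> [/ku|->].
have f_inj : injective f.
  move=> j k fjk; have [l [_ lu]] := grow (f j).
  rewrite -(lu j); last exact/fP.
  by apply: lu; apply/fP.
have /boolp.choice[d dP] : forall j, exists a : 'Z_e, g (f j) j = z a.
  by move=> j; apply: zeta_powP => //; apply: ge; apply/fP.
exists (perm f_inj), d; apply/matrixP => i j; rewrite mxE permE.
case: eqP => [-> //|/eqP fj]; apply/eqP; apply: contraNT fj.
by move=> /fP ->.
Qed.

Lemma det_monomial_mx s d :
  \det (monomial_mx s d) = (-1) ^+ s * \prod_i z (d i).
Proof.
have -> : monomial_mx s d = (diag_mx (\row_i z (d i)) *m perm_mx s)^T.
  apply/matrixP => i j; rewrite !mxE (bigD1 j) //= big1 => [|k kj].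
    by rewrite !mxE eqxx mulr1n addr0 eq_sym; case: eqP; rewrite ?mulr1 ?mulr0.
  by rewrite !mxE eq_sym (negPf kj) mulr0n mul0r.
rewrite det_tr det_mulmx det_diag det_perm mulrC; congr (_ * _).
by apply: eq_bigr => i _; rewrite mxE.
Qed.

(** Under x_(s k) = zeta^(d k) y_k, the equation y_i = zeta^a y_j becomes x_(s i) = zeta^(a + d i -
    d j) x_(s j). *)
Lemma monomial_mx_hyp_line s d i j a :
  (mulmx (monomial_mx s d) @` hyp_set (inl (i, j, a)))%classic =
  hyp_set (inl (s i, s j, a + d i - d j)).
Proof.
have zz b c (u v : C) : z b * u - z (c + b) * v = z b * (u - z c * v).
  by rewrite zeta_powD //; ring.
have abE : a + d i - d j + d j = a + d i by rewrite subrK.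
apply/seteqP; split=> x /=.
  case=> y yH <-; rewrite !monomial_mx_mulE mulrA -zeta_powD // abE zz yH.
  by rewrite mulr0.
move=> xH; pose y : V := \col_k (z (- d k) * x (s k) 0).
exists y; last first.
  apply/colP => k; rewrite -[k](permKV s) monomial_mx_mulE mxE mulrA.
  by rewrite -zeta_powD // subrr zeta_pow0 mul1r.
apply: (mulfI (zeta_pow_neq0 R (d i))); rewrite mulr0 -zz !mxE.
by rewrite !mulrA -!zeta_powD // subrr zeta_pow0 mul1r -xH.
Qed.

Lemma monomial_mx_hyp_coord s d i :
  (mulmx (monomial_mx s d) @` hyp_set (inr i))%classic = hyp_set (inr (s i)).
Proof.
apply/seteqP; split=> x /=.
  by case=> y yH <-; rewrite monomial_mx_mulE yH mulr0.
move=> xH; pose y : V := \col_k (z (- d k) * x (s k) 0).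
exists y; first by rewrite mxE xH mulr0.
apply/colP => k; rewrite -[k](permKV s) monomial_mx_mulE mxE mulrA.
by rewrite -zeta_powD // subrr zeta_pow0 mul1r.
Qed.

Lemma hyp_set_swap i j a :
  hyp_set (inl (i, j, a)) = hyp_set (inl (j, i, - a)).
Proof.
have h b (u v : C) : u - z b * v = - z b * (v - z (- b) * u).
  by rewrite zeta_powN //; field; exact: zeta_pow_neq0.
apply/seteqP; split=> x /= xH.
  by rewrite h opprK xH mulr0.
by rewrite h xH mulr0.
Qed.

End MonomialMatrices.

(** * The arrangement, and uniqueness of the values of [hyp_act] and [lambda] *)

Section Arrangement.
Variables (R : realType) (e n : nat).
Hypothesis e_gt1 : (1 < e)%N.
Local Notation C := R[i].
Local Notation V := 'cV[C]_n.
Local Notation z := (@zeta_pow R e).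
Local Notation delta i := (delta_mx i 0 : V).
Local Notation hyp_set := (@hyp_set R e n).
Local Notation hyp_normal := (@hyp_normal R e n).
Local Notation arrangement := (@arrangement e n).
Implicit Types (s : 'S_n) (d : 'I_n -> 'Z_e) (a b : 'Z_e) (i j k l m : 'I_n).

(** [brk2] accepts i and j in either order, whereas the arrangement keeps only i < j; since H_ij(a)
    = H_ji(- a), this is the representative that is kept. *)
Definition line_index i j a : hyp_index e n :=
  if (i < j)%N then inl (i, j, a) else inl (j, i, - a).

(* hyp_normal (inl (i, j, a)) is this multiple of the normal vector that the  *)
(* arrangement attaches to H_ij(a), see hyp_normal_line.                      *)
Definition line_coef i j a : C := if (i < j)%N then 1 else - z (- a).

Lemma line_in_arrangement i j a : i != j -> in_arrangement (line_index i j a).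
Proof.
move=> ij; rewrite /line_index; case: ifP => //= /negbT.
by rewrite -leqNgt leq_eqVlt eq_sym -val_eqE /= in ij *; rewrite (negPf ij).
Qed.

Lemma hyp_set_line i j a :
  hyp_set (line_index i j a) = hyp_set (inl (i, j, a)).
Proof. by rewrite /line_index; case: ifP => // _; rewrite -hyp_set_swap. Qed.

Lemma hyp_normal_line i j a :
  hyp_normal (inl (i, j, a)) = line_coef i j a *: hyp_normal (line_index i j a).
Proof.
rewrite /line_index /line_coef; case: ifP => _; first by rewrite scale1r.
rewrite /= opprK scalerBr !scaleNr opprK scalerA zeta_powN //.
by rewrite mulVf ?zeta_pow_neq0 // scale1r addrC.
Qed.

(** The coefficient has modulus 1. As G acts on symbols through the inverse conjugate of lambda,
    this is what makes [H_ij(a)] transform like its normal vector for either order of i and j. *)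
Lemma line_coef_conj i j a : (conjc (line_coef i j a))^-1 = line_coef i j a.
Proof.
rewrite /line_coef; case: ifP => _; first by rewrite rmorph1 invr1.
by rewrite -[RHS]invrK invrN -conjc_zeta_pow // rmorphN.
Qed.

Lemma line_coef_neq0 i j a : line_coef i j a != 0.
Proof.
by rewrite /line_coef; case: ifP => _; rewrite ?oner_eq0 // oppr_eq0 zeta_pow_neq0.
Qed.

Lemma hyp_normal_neq0 (H : arrangement) : hyp_normal (val H) != 0.
Proof.
case: H => -[[[i j] a]|i] /= Hij; apply/eqP=> /colP /(_ i) /eqP.
  by rewrite !mxE !eqxx /= -val_eqE ltn_eqF //= mulr0 subr0 oner_eq0.
by rewrite !mxE !eqxx oner_eq0.
Qed.

Lemma delta_in_line i j a k : i != j ->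
  hyp_set (inl (i, j, a)) (delta k) <-> k \notin [:: i; j].
Proof.
move=> ij /=; rewrite !mxE !andbT !inE [i == k]eq_sym [j == k]eq_sym.
have [->|_] := eqVneq k i.
  rewrite (negPf ij) mulr0 subr0; split=> [/eqP|//].
  by rewrite oner_eq0.
have [_|_] := eqVneq k j; last by rewrite mulr0 subr0; split.
by rewrite mulr1 sub0r; split=> [/eqP|//]; rewrite oppr_eq0 (negPf (zeta_pow_neq0 _ _)).
Qed.

Lemma delta_in_coord i k : hyp_set (inr i) (delta k) <-> k != i.
Proof.
rewrite /= mxE andbT eq_sym; have [_|_] := eqVneq k i; last by split.
by split=> // /eqP; rewrite oner_eq0.
Qed.

(** The basis vectors lying on a hyperplane reveal its indices, and zeta^a e_i + e_j, which lies on
    H_ij(b) only for b = a, reveals the parameter. This makes the value picked by [hyp_act]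
    unique. *)
Lemma hyp_set_inj : injective (fun H : arrangement => hyp_set (val H)).
Proof.
have coord_line i j k a : (i < j)%N -> hyp_set (inr k) <> hyp_set (inl (i, j, a)).
  move=> ij H; have nij : i != j by rewrite -val_eqE ltn_eqF.
  have ki : i = k.
    apply/eqP; rewrite -[_ == _]negbK; apply/negP.
    by move/(delta_in_coord k i); rewrite H => /(delta_in_line _ _ nij); rewrite !inE eqxx.
  have kj : j = k.
    apply/eqP; rewrite -[_ == _]negbK; apply/negP.
    by move/(delta_in_coord k j); rewrite H => /(delta_in_line _ _ nij); rewrite !inE eqxx orbT.
  by rewrite ki kj eqxx in nij.
case=> -[[[i j] a]|i] Hi [[[[k l] b]|k] Hk] /= HH; apply: val_inj => /=;
  rewrite /= in Hi Hk.
- have {}HH : hyp_set (inl (i, j, a)) = hyp_set (inl (k, l, b)) := HH.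
  have ij : i != j by rewrite -val_eqE ltn_eqF.
  have kl : k != l by rewrite -val_eqE ltn_eqF.
  have mm m : (m \in [:: i; j]) = (m \in [:: k; l]).
    apply/idP/idP; apply: contraTT.
      by move/(delta_in_line b m kl); rewrite -HH => /(delta_in_line a m ij).
    by move/(delta_in_line a m ij); rewrite HH => /(delta_in_line b m kl).
  have := mm i; have := mm j; have := mm k; rewrite !inE !eqxx ?orbT /=.
  have [ek|nk] := eqVneq k i; last first.
    (* Here k = j and l = i, which contradicts i < j and k < l. *)
    move=> /= /eqP kj _ /esym/eqP il.
    by move: Hi Hk; rewrite kj il => /ltnW; rewrite leqNgt => /negPf ->.
  rewrite ek [j == i]eq_sym (negPf ij) /= => _ /esym/eqP jl _.
  rewrite ek -jl in HH *.
  have : hyp_set (inl (i, j, a)) (z a *: delta i + delta j).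
    rewrite /= !mxE !eqxx (negPf ij) eq_sym (negPf ij) /=.
    by rewrite !mulr1 mulr0 addr0 add0r mulr1 subrr.
  rewrite HH /= !mxE !eqxx (negPf ij) eq_sym (negPf ij) /=.
  rewrite !mulr1 mulr0 addr0 add0r mulr1 => /eqP; rewrite subr_eq0 => /eqP.
  by move/(zeta_pow_inj e_gt1) ->.
- by case: (coord_line _ _ _ _ Hi (esym HH)).
- by case: (coord_line _ _ _ _ Hk HH).
- have {}HH : hyp_set (inr i) = hyp_set (inr k) := HH.
  congr inr; apply/eqP; rewrite eq_sym -[_ == _]negbK; apply/negP.
  by move/(delta_in_coord i k); rewrite HH => /delta_in_coord; rewrite eqxx.
Qed.

Lemma hyp_act_eq (g : 'M[C]_n) (H H' : arrangement) :
  hyp_set (val H') = (mulmx g @` hyp_set (val H))%classic -> hyp_act g H = H'.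
Proof.
move=> gH; apply: xget_unique => // H'' HH; apply: hyp_set_inj.
by rewrite HH gH.
Qed.

Lemma lambda_eq (g : 'M[C]_n) (H : arrangement) (c : C) :
  g *m hyp_normal (val H) = c *: hyp_normal (val (hyp_act g H)) ->
  lambda g H = c.
Proof.
move=> gc; apply: xget_unique => // c' /=; rewrite gc => /eqP.
rewrite -subr_eq0 -scalerBl scaler_eq0 (negPf (hyp_normal_neq0 _)) orbF.
by rewrite subr_eq0 => /eqP.
Qed.

End Arrangement.

(** * Stabilizers of hyperplanes and the reflections g_H *)

Section Reflections.
Variables (R : realType) (e n : nat).
Hypothesis e_gt1 : (1 < e)%N.
Local Notation C := R[i].
Local Notation V := 'cV[C]_n.
Local Notation z := (@zeta_pow R e).
Local Notation delta i := (delta_mx i 0 : V).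
Local Notation hyp_set := (@hyp_set R e n).
Local Notation arrangement := (@arrangement e n).
Local Notation monomial_mx := (@monomial_mx R e n).
Implicit Types (s : 'S_n) (d : 'I_n -> 'Z_e) (a b : 'Z_e) (i j k l m : 'I_n).

(** The phases for which the reflection exchanges zeta^a e_i and e_j, and so fixes their sum. *)
Definition line_phase i j a k : 'Z_e :=
  if k == i then - a else if k == j then a else 0.

Definition line_refl i j a : 'M[C]_n :=
  monomial_mx (tperm i j) (line_phase i j a).

Definition coord_phase i a k : 'Z_e := if k == i then a else 0.

Definition coord_refl i a : 'M[C]_n := monomial_mx 1 (coord_phase i a).

Lemma line_refl_sym i j a : i != j -> line_refl j i (- a) = line_refl i j a.
Proof.
move=> ij; apply: eq_mx_delta => k; rewrite !monomial_mx_delta tpermC.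
rewrite /line_phase opprK; have [->|//] := eqVneq k j.
by rewrite eq_sym (negPf ij).
Qed.

Lemma det_line_refl i j a : i != j -> \det (line_refl i j a) = -1.
Proof.
move=> ij; rewrite det_monomial_mx odd_tperm ij expr1.
rewrite (bigD1 i) //= (bigD1 j) 1?eq_sym //= big1 ?mulr1 => [|k].
  rewrite /line_phase !eqxx eq_sym (negPf ij) -zeta_powD // addNr zeta_pow0.
  by rewrite mulr1.
by case/andP=> ki kj; rewrite /line_phase (negPf ki) (negPf kj) zeta_pow0.
Qed.

Lemma det_coord_refl i a : \det (coord_refl i a) = z a.
Proof.
rewrite det_monomial_mx odd_perm1 expr0 mul1r (bigD1 i) //= big1 ?mulr1 => [|k ki].
  by rewrite /coord_phase eqxx.
by rewrite /coord_phase (negPf ki) zeta_pow0.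
Qed.

Lemma monomial_mx_deltaI s d k :
  monomial_mx s d *m delta k = delta k -> s k = k /\ d k = 0.
Proof.
rewrite monomial_mx_delta => /colP /(_ k); rewrite !mxE !eqxx !andbT /=.
have [ks|_] := eqVneq k (s k).
  by rewrite mulr1 -(zeta_pow0 R e) => /(@zeta_pow_inj R e e_gt1).
by rewrite mulr0 => /esym/eqP; rewrite oner_eq0.
Qed.

(** An element of the stabilizer fixes every e_k with k outside {i, j}, so its permutation preserves
    {i, j}. It also fixes zeta^a e_i + e_j, and comparing coordinates determines both phases: they
    are trivial if i is fixed, and those of the reflection if i and j are exchanged. *)
Lemma stabilizer_line (H : arrangement) i j a : val H = inl (i, j, a) ->
  stabilizer H = [set` [fset 1%:M; line_refl i j a]%fset]%classic.
Proof.
move=> HE; have ij : i != j.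
  by have := valP H; rewrite HE /= => lt; rewrite -val_eqE ltn_eqF.
rewrite /stabilizer HE; apply/seteqP; split=> g /=; rewrite !inE; last first.
  case/orP=> /eqP ->.
    by split=> [|x _]; rewrite ?mul1mx // -(@monomial_mx1 R e n); apply: monomial_mxP.
  split=> [|x xH]; first exact: monomial_mxP.
  apply/colP => k; rewrite -[k](permKV (tperm i j)) monomial_mx_mulE.
  move: (_ k) => {}k; move/eqP: xH; rewrite subr_eq0 /line_phase => /eqP xH.
  case: tpermP => [->|->|/eqP ki /eqP kj].
  - by rewrite eqxx xH mulrA -zeta_powD // addNr zeta_pow0 mul1r.
  - by rewrite eqxx eq_sym (negPf ij) -xH.
  - by rewrite (negPf ki) (negPf kj) zeta_pow0 mul1r.
case=> /(G_e1nP e_gt1)[s [d ->]] fixH.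
have fixk k : k \notin [:: i; j] -> s k = k /\ d k = 0.
  by move=> kij; apply: monomial_mx_deltaI; apply: fixH; apply/delta_in_line.
have /fixH : hyp_set (inl (i, j, a)) (z a *: delta i + delta j).
  rewrite /= !mxE !eqxx (negPf ij) eq_sym (negPf ij) /=.
  by rewrite !mulr1 mulr0 addr0 add0r mulr1 subrr.
rewrite mulmxDr -scalemxAr !monomial_mx_delta scalerA => /colP fixij.
(* If s k were outside {i, j}, it would be a fixed point of s, hence equal to k. *)
have sij k : k \in [:: i; j] -> s k \in [:: i; j].
  move=> kij; apply: contraTT kij => skij; have [ssk _] := fixk _ skij.
  by rewrite -(perm_inj ssk).
have := sij i; rewrite !inE eqxx => /(_ isT) si.
have := sij j; rewrite !inE eqxx orbT => /(_ isT) sj.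
apply/orP; case/orP: si => /eqP si.
  have {}sj : s j = j.
    by case/orP: sj => /eqP // sj; case/negP: ij; rewrite -(inj_eq (@perm_inj _ s)) si sj.
  left; apply/eqP; rewrite -(@monomial_mx1 R e n); apply: eq_mx_delta => k.
  rewrite !monomial_mx_delta perm1.
  have := fixij i; have := fixij j; rewrite si sj !mxE !eqxx (negPf ij) eq_sym (negPf ij) /=.
  rewrite !(mulr1, mulr0, addr0, add0r) => dj di.
  have {}dj : d j = 0 by apply: (@zeta_pow_inj R e e_gt1); rewrite dj zeta_pow0.
  have {}di : d i = 0.
    apply: (@zeta_pow_inj R e e_gt1); apply: (mulfI (zeta_pow_neq0 R a)).
    by rewrite di zeta_pow0 mulr1.
  have [->|ki] := eqVneq k i; first by rewrite si di.
  have [->|kj] := eqVneq k j; first by rewrite sj dj.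
  by have [|-> ->] := fixk k; rewrite ?inE ?negb_or ?ki.
have {}sj : s j = i.
  by case/orP: sj => /eqP // sj; case/negP: ij; rewrite -(inj_eq (@perm_inj _ s)) si sj.
right; apply/eqP; apply: eq_mx_delta => k; rewrite !monomial_mx_delta.
have := fixij i; have := fixij j; rewrite si sj !mxE !eqxx (negPf ij) eq_sym (negPf ij) /=.
rewrite !(mulr1, mulr0, addr0, add0r) => dj di.
have {}di : d j = a by apply: (@zeta_pow_inj R e e_gt1).
have {}dj : d i = - a.
  apply: (@zeta_pow_inj R e e_gt1); apply: (mulfI (zeta_pow_neq0 R a)).
  by rewrite dj -zeta_powD // subrr zeta_pow0.
rewrite /line_phase; case: tpermP => [->|->|/eqP ki /eqP kj].
- by rewrite eqxx si dj.
- by rewrite eqxx eq_sym (negPf ij) sj di.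
- rewrite (negPf ki) (negPf kj).
  by have [|-> ->] := fixk k; rewrite ?inE ?negb_or ?ki.
Qed.

Lemma stab_order_line (H : arrangement) i j a : val H = inl (i, j, a) ->
  stab_order R H = 2.
Proof.
move=> HE; have ij : i != j.
  by have := valP H; rewrite HE /= => lt; rewrite -val_eqE ltn_eqF.
rewrite /stab_order (stabilizer_line HE) set_fsetK cardfs2.
suff -> : 1%:M != line_refl i j a by [].
apply/eqP=> h; have := det_line_refl a ij; rewrite -h det1 => /eqP.
by rewrite -addr_eq0 -[1 + 1]/(2%:R) pnatr_eq0.
Qed.

Lemma reflection_line (H : arrangement) i j a : val H = inl (i, j, a) ->
  reflection R H = line_refl i j a.
Proof.
move=> HE; have ij : i != j.
  by have := valP H; rewrite HE /= => lt; rewrite -val_eqE ltn_eqF.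
rewrite /reflection (stab_order_line HE) expi2 (stabilizer_line HE).
apply: xget_unique => [|g] /=.
  by rewrite !inE eqxx orbT det_line_refl.
rewrite !inE => -[/orP[/eqP ->|/eqP ->//]].
by rewrite det1 => /eqP; rewrite -addr_eq0 -[1 + 1]/(2%:R) pnatr_eq0.
Qed.

Lemma stabilizer_coord (H : arrangement) i : val H = inr i ->
  stabilizer H = [set` [fset coord_refl i a | a in 'Z_e]%fset]%classic.
Proof.
move=> HE; rewrite /stabilizer HE; apply/seteqP; split=> g /=.
  case=> /(G_e1nP e_gt1)[s [d ->]] fixH.
  have fixk k : k != i -> s k = k /\ d k = 0.
    by move=> ki; apply: monomial_mx_deltaI; apply: fixH; apply/delta_in_coord.
  apply/imfsetP; exists (d i) => //; apply: eq_mx_delta => k.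
  rewrite !monomial_mx_delta perm1 /coord_phase.
  have [->|/fixk[-> ->]//] := eqVneq k i.
  have [->//|/fixk[si _]] := eqVneq (s i) i.
  by rewrite (perm_inj si).
case/imfsetP=> a _ ->; split=> [|x xi]; first exact: monomial_mxP.
apply/colP => k; rewrite -{1}[k](perm1 k) monomial_mx_mulE /coord_phase.
by case: eqP => [->|_]; rewrite ?xi ?mulr0 // zeta_pow0 mul1r.
Qed.

(** The determinant zeta^a tells the e elements of the stabilizer apart. *)
Lemma stab_order_coord (H : arrangement) i : val H = inr i ->
  stab_order R H = e.
Proof.
move=> HE; rewrite /stab_order (stabilizer_coord HE) set_fsetK card_imfset /=.
  by rewrite -cardE card_ord Zp_cast.
by move=> a b h; apply: (@zeta_pow_inj R e e_gt1); rewrite -!(det_coord_refl i) h.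
Qed.

Lemma reflection_coord (H : arrangement) i : val H = inr i ->
  reflection R H = coord_refl i 1.
Proof.
move=> HE; rewrite /reflection (stab_order_coord HE) (stabilizer_coord HE).
have z1 : expi R e = z 1 by rewrite (zeta_pow_nat R e_gt1 1).
apply: xget_unique => [|g] /=.
  split; first by apply/imfsetP; exists 1.
  by rewrite det_coord_refl.
case=> /imfsetP[a _ ->]; rewrite det_coord_refl z1.
by move/(@zeta_pow_inj R e e_gt1) ->.
Qed.

Lemma coord_reflX i (p : nat) : coord_refl i 1 ^+ p = coord_refl i p%:R.
Proof.
rewrite [LHS]monomial_mx1X //; apply: eq_mx_delta => k.
rewrite !monomial_mx_delta.
by rewrite /coord_phase; case: eqP; rewrite ?mul0rn.
Qed.

End Reflections.

(** * The value of 1 + Psi on products of two generators *)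

Section Braiding.
Variables (R : realType) (e n : nat).
Hypothesis e_gt1 : (1 < e)%N.
Local Notation C := R[i].
Local Notation z := (@zeta_pow R e).
Local Notation arrangement := (@arrangement e n).
Local Notation symbol := (@symbol R e n).
Local Notation T := {malg C[{fmonom symbol}]}.
Local Notation sigma := (sigma (@braiding_G R e n)).
Local Notation monomial_mx := (@monomial_mx R e n).
Local Notation Hr := (@brk2 R e n).
Local Notation Hd := (@brk1 R e n).
Implicit Types (s : 'S_n) (d : 'I_n -> 'Z_e) (a b : 'Z_e) (i j k l : 'I_n).
Implicit Types (H : arrangement) (p q : nat).

Definition sym_elt (H : hyp_index e n) p : T := tensor_of (basis_vec R H p).

Lemma basis_vec_symbol H p : (0 < p < stab_order R H)%N ->
  exists x : symbol, [/\ tag x = H, symbol_exp x = p &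
    basis_vec R (val H) p = [ffun y => (y == x)%:R]].
Proof.
case/andP=> p0 ps; have lt_p : (p.-1 < (stab_order R H).-1)%N.
  by case: p p0 ps => // p _; case: (stab_order R H).
exists (Tagged (fun H => 'I_(stab_order R H).-1) (Ordinal lt_p)).
split; rewrite /symbol_exp /= ?prednK //; apply/ffunP => -[H' r]; rewrite !ffunE /=.
congr (_%:R); rewrite val_eqE /symbol_exp /=.
have [HH|nHH] := eqVneq H' H; last first.
  by rewrite -tag_eqE /tag_eq /= (negPf nHH).
subst H'; rewrite eq_Tagged /= -val_eqE /=.
by rewrite -{1}(prednK p0) eqSS.
Qed.

(** This is x y + g(y) x with x = [H; p] and y = [H'; q], where g = g_H^p is the degree of x. *)
Lemma sigma_sym_elt H H' p q :
    (0 < p < stab_order R H)%N -> (0 < q < stab_order R H')%N ->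
  sigma (sym_elt (val H) p * sym_elt (val H') q) =
  sym_elt (val H) p * sym_elt (val H') q +
  (conjc (lambda (reflection R H ^+ p) H'))^-1 *:
    (sym_elt (val (hyp_act (reflection R H ^+ p) H')) q * sym_elt (val H) p).
Proof.
move=> /basis_vec_symbol[x [xH xp bx]] /basis_vec_symbol[y [yH yq by_]].
rewrite /sym_elt bx by_ !tensor_of_delta word_mul sigma_word2 /=.
congr (_ + _); set g := reflection R H ^+ p.
have -> : (conjc (lambda g H'))^-1 *: (tensor_of (basis_vec R (val (hyp_act g H')) q)
    * word C [:: x]) = tensor_of (act_symbol g y) * word C [:: x].
  rewrite scalerAl; congr (_ * _); rewrite -tensor_ofZ /act_symbol yH yq.
  by congr tensor_of; apply/ffunP => u; rewrite !ffunE.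
have gx : deg_symbol x = g by rewrite /deg_symbol xH xp.
rewrite tensor_of_mul_word; apply: eq_bigr => u _.
by rewrite /braiding_G ffunE gx.
Qed.

Lemma sigmaZ (c : C) (x : T) : sigma (c *: x) = c *: sigma x.
Proof. exact: linear_extZ. Qed.

Lemma sigmaD (x y : T) : sigma (x + y) = sigma x + sigma y.
Proof. exact: linear_extD. Qed.

Lemma sigmaB (x y : T) : sigma (x - y) = sigma x - sigma y.
Proof. exact: linear_ext_additive. Qed.

Definition line_hyp i j a (ij : i != j) : arrangement :=
  Sub (line_index i j a) (line_in_arrangement a ij).

Definition coord_hyp i : arrangement :=
  Sub (inr i : hyp_index e n) (isT : in_arrangement (inr i : hyp_index e n)).

Lemma brk2E i j a : Hr i j a = line_coef R i j a *: sym_elt (line_index i j a) 1.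
Proof.
by rewrite /brk2 /line_coef /line_index; case: ifP; rewrite ?scale1r.
Qed.

Lemma brk1E i p : Hd i p = sym_elt (val (coord_hyp i)) p.
Proof. by []. Qed.

Lemma stab_order_line_hyp i j a (ij : i != j) :
  stab_order R (line_hyp a ij) = 2.
Proof.
have : val (line_hyp a ij) = line_index i j a by [].
by rewrite /line_index; case: ifP => _; apply: stab_order_line.
Qed.

Lemma reflection_line_hyp i j a (ij : i != j) :
  reflection R (line_hyp a ij) = line_refl R i j a.
Proof.
have : val (line_hyp a ij) = line_index i j a by [].
rewrite /line_index; case: ifP => _ h; first exact: reflection_line.
by rewrite (reflection_line R e_gt1 h) line_refl_sym.
Qed.

Lemma stab_order_coord_hyp i : stab_order R (coord_hyp i) = e.
Proof. by apply: stab_order_coord. Qed.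

Lemma reflection_coord_hyp i : reflection R (coord_hyp i) = coord_refl R i (1 : 'Z_e).
Proof. by apply: reflection_coord. Qed.

(** On normal vectors, g sends e_k - zeta^(-b) e_l to zeta^(d k) times the normal vector of H_(s
    k)(s l)(b + d k - d l), whatever the order of the indices. Passing to the vectors of the
    arrangement multiplies lambda by a quotient of [line_coef], which the definition of [brk2]
    compensates. *)
Lemma sigma_line s d H p k l b : k != l -> (0 < p < stab_order R H)%N ->
    reflection R H ^+ p = monomial_mx s d ->
  sigma (sym_elt (val H) p * Hr k l b) = sym_elt (val H) p * Hr k l b +
    z (d k) *: (Hr (s k) (s l) (b + d k - d l) * sym_elt (val H) p).
Proof.
move=> kl pH gE; have skl : s k != s l by rewrite (inj_eq perm_inj).
have act : hyp_act (monomial_mx s d) (line_hyp b kl) =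
           line_hyp (b + d k - d l) skl.
  by apply: hyp_act_eq => //; rewrite !hyp_set_line // monomial_mx_hyp_line.
have lam : lambda (monomial_mx s d) (line_hyp b kl) =
    z (d k) * line_coef R (s k) (s l) (b + d k - d l) / line_coef R k l b.
  apply: lambda_eq; rewrite act; apply: (scalerI (line_coef_neq0 R k l b)).
  rewrite scalemxAr -hyp_normal_line // mulrC !scalerA mulrA divff ?mul1r; last first.
    exact: line_coef_neq0.
  rewrite -scalerA -hyp_normal_line //= mulmxBr -scalemxAr !monomial_mx_delta.
  rewrite scalerBr !scalerA -!zeta_powD //.
  by congr (_ - z _ *: _); ring.
rewrite !brk2E malg_scalerAr sigmaZ.
rewrite (@sigma_sym_elt H (line_hyp b kl) p 1) ?stab_order_line_hyp //.
rewrite gE act lam scalerDr.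
rewrite -[in RHS]scalerAl !scalerA.
(* The hypotheses say that x, y and u have modulus 1, so the inverse conjugate leaves x u / y
   unchanged. *)
have conjMV x y u : y != 0 -> (conjc x)^-1 = x -> (conjc y)^-1 = y ->
    (conjc u)^-1 = u -> y * (conjc (x * u / y))^-1 = x * u :> C.
  move=> y0 xx yy uu; rewrite rmorphM /= invfM rmorphM /= invfM fmorphV /=.
  by rewrite xx yy uu mulrCA divff ?mulr1.
rewrite conjMV // ?line_coef_conj //; first exact: line_coef_neq0.
by rewrite conjc_zeta_pow // invrK.
Qed.

Lemma sigma_coord s d H p k q :
    (0 < p < stab_order R H)%N -> (0 < q < e)%N ->
    reflection R H ^+ p = monomial_mx s d ->
  sigma (sym_elt (val H) p * Hd k q) = sym_elt (val H) p * Hd k q +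
    z (d k) *: (Hd (s k) q * sym_elt (val H) p).
Proof.
move=> pH qe gE.
have act : hyp_act (monomial_mx s d) (coord_hyp k) = coord_hyp (s k).
  by apply: hyp_act_eq => //; rewrite monomial_mx_hyp_coord.
have lam : lambda (monomial_mx s d) (coord_hyp k) = z (d k).
  by apply: lambda_eq; rewrite act /= monomial_mx_delta.
have qk : (0 < q < stab_order R (coord_hyp k))%N by rewrite stab_order_coord_hyp.
rewrite !brk1E (sigma_sym_elt pH qk) gE act lam.
by rewrite conjc_zeta_pow invrK.
Qed.

Section LineOnLeft.
Variables (i j : 'I_n) (a : 'Z_e).
Hypothesis ij : i != j.
Let t := tperm i j.
Let d := line_phase i j a.

Lemma sigma_line_line k l b : k != l ->
  sigma (Hr i j a * Hr k l b) = Hr i j a * Hr k l b +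
    z (d k) *: (Hr (t k) (t l) (b + d k - d l) * Hr i j a).
Proof.
move=> kl; rewrite (brk2E i j a) -scaler_braid -scalerAl sigmaZ; congr (_ *: _).
apply: (@sigma_line t d (line_hyp a ij)) => //; first by rewrite stab_order_line_hyp.
by rewrite expr1 reflection_line_hyp.
Qed.

Lemma sigma_line_coord k q : (0 < q < e)%N ->
  sigma (Hr i j a * Hd k q) = Hr i j a * Hd k q +
    z (d k) *: (Hd (t k) q * Hr i j a).
Proof.
move=> qe; rewrite (brk2E i j a) -scaler_braid -scalerAl sigmaZ; congr (_ *: _).
apply: (@sigma_coord t d (line_hyp a ij)) => //; first by rewrite stab_order_line_hyp.
by rewrite expr1 reflection_line_hyp.
Qed.

End LineOnLeft.

Section CoordOnLeft.
Variables (i : 'I_n) (p : nat).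
Hypothesis pe : (0 < p < e)%N.
Let d := coord_phase i (p%:R : 'Z_e).

Let p_lt_order : (0 < p < stab_order R (coord_hyp i))%N.
Proof. by rewrite stab_order_coord_hyp. Qed.

Let reflX : reflection R (coord_hyp i) ^+ p = monomial_mx 1 d.
Proof. by rewrite reflection_coord_hyp coord_reflX. Qed.

Lemma sigma_coord_line k l b : k != l ->
  sigma (Hd i p * Hr k l b) = Hd i p * Hr k l b +
    z (d k) *: (Hr k l (b + d k - d l) * Hd i p).
Proof.
move=> kl; have := sigma_line b kl p_lt_order reflX.
by rewrite !perm1 -!brk1E.
Qed.

Lemma sigma_coord_coord k q : (0 < q < e)%N ->
  sigma (Hd i p * Hd k q) = Hd i p * Hd k q + z (d k) *: (Hd k q * Hd i p).
Proof.
move=> qe; have := sigma_coord k p_lt_order qe reflX.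
by rewrite !perm1 -!brk1E.
Qed.

End CoordOnLeft.

(** Same scalar as for normal vectors: e_j - zeta^a e_i = - zeta^a (e_i - zeta^(-a) e_j). *)
Lemma brk2_sym i j a : i != j -> Hr j i (- a) = - z a *: Hr i j a.
Proof.
rewrite -val_eqE neq_ltn /brk2 => /orP[] lt.
  have -> : (j < i)%N = false by rewrite ltnNge ltnW.
  by rewrite lt !opprK.
have -> : (i < j)%N = false by rewrite ltnNge ltnW.
by rewrite lt scalerA mulrNN -(zeta_powD _ e_gt1) subrr zeta_pow0 scale1r.
Qed.

End Braiding.

(** * Telescoping along a cycle, with f in the role of 1 + Psi *)

Section LinearRelations.
Variables (F : fieldType) (M : lmodType F) (f : M -> M).
Hypothesis fD : {morph f : x y / x + y}.
Hypothesis fB : {morph f : x y / x - y}.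
Hypothesis fZ : forall c, {morph f : x / c *: x}.
Implicit Types (x y v w : M) (c d : F).

Lemma two_terms x y : f x = x + y -> f y = y + x -> f (x - y) = 0.
Proof. by move=> fx fy; rewrite fB fx fy [y + x]addrC subrr. Qed.

(** f - 1 sends each of x, - c w, - y to minus the next one, cyclically; c c' = 1 makes the scalars
    match. [four_terms] follows the same pattern with x, - c y, c v, - d' w. *)
Lemma three_terms x y w c c' :
    f x = x + c *: w -> f w = w - c' *: y -> f y = y + x -> c * c' = 1 ->
  f (x - c *: w - y) = 0.
Proof.
move=> fx fw fy cc; rewrite !fB fZ fx fw fy scalerBr scalerA cc scale1r.
by rewrite addrKA opprK addrKA subrr.
Qed.

Lemma four_terms x y v w c c' d d' :
    f x = x + c *: y -> f y = y + v -> f v = v + c' *: w ->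
    f w = w + d *: x -> c * c' = d' -> d' * d = 1 ->
  f (x - c *: y + c *: v - d' *: w) = 0.
Proof.
move=> fx fy fv fw cc dd; rewrite fB fD fB !fZ fx fy fv fw !scalerDr !scalerA cc dd.
by rewrite scale1r addrKA subrKA addrKA subrr.
Qed.

(** The A p are the even-numbered and the B q the odd-numbered terms among U 1, ..., U (2 N), so f
    of the total is U 1 - U (2 N + 1). *)
Lemma telescope_odd_even (U A B : nat -> M) N :
    (forall m, f (U m) = U m - U m.+1) -> U 1%N = U (2 * N).+1 ->
    (forall p, A p = U (2 * p)%N) ->
    (forall q, (0 < q)%N -> B q = U (2 * q - 1)%N) ->
  f (\sum_(1 <= p < N.+1) A p + \sum_(1 <= q < N.+1) B q) = 0.
Proof.
move=> fU UN AU BU; rewrite -big_split /=.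
have f0 : f 0 = 0 by have := fB 0 0; rewrite !subrr.
rewrite (big_morph f fD f0).
(* Pairing gives f (A q + B q) = U (2 q - 1) - U (2 q + 1), a telescoping sum over odd indices. *)
transitivity (- (U (2 * N.+1 - 1)%N - U (2 * 1 - 1)%N)).
  rewrite -(@telescope_sumr _ 1 N.+1 (fun q => U (2 * q - 1)%N)) // -sumrN.
  apply: eq_big_nat => -[|q] // _.
  rewrite fD AU BU // !fU !mulnS !subSS !subn0 addrC.
  by rewrite subrKA opprB.
by rewrite mulnS subSS subn0 -UN subrr oppr0.
Qed.

End LinearRelations.

(** * The six relations *)

Section Relations.
Variables (R : realType) (e n : nat).
Hypothesis e_gt1 : (1 < e)%N.
Local Notation C := R[i].
Local Notation z := (@zeta_pow R e).
Local Notation sigma := (sigma (@braiding_G R e n)).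
Local Notation Hr := (@brk2 R e n).
Local Notation Hd := (@brk1 R e n).
Local Notation cl := (@cls R e n).
Implicit Types (a b : 'Z_e) (i j k l : 'I_n).
Let zD := @zeta_powD R e e_gt1.

Let sD : {morph sigma : x y / x + y} := @sigmaD R e n.
Let sB : {morph sigma : x y / x - y} := @sigmaB R e n.
Let sZ c : {morph sigma : x / c *: x} := @sigmaZ R e n c.

Lemma uniq3 i j k : uniq [:: i; j; k] -> [/\ i != j, i != k & j != k].
Proof. by rewrite /= !inE negb_or !andbT => /andP[/andP[? ?] ?]. Qed.

(** With X = [H_ij(a)], Y = [H_jk(b)] and W = [H_ik(a + b)], Psi runs through X Y, W X, Y W and back
    to X Y, up to scalars. *)
Lemma cls_line_path i j k a b : uniq [:: i; j; k] ->
  cl (Hr i j a * Hr j k b - z a *: (Hr i k (a + b) * Hr i j a)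
      - Hr j k b * Hr i k (a + b)) = 0.
Proof.
case/uniq3=> ij ik jk.
have ji := ij; have ki := ik; have kj := jk; rewrite eq_sym in ji.
rewrite eq_sym in ki; rewrite eq_sym in kj.
have sXY : sigma (Hr i j a * Hr j k b) =
    Hr i j a * Hr j k b + z a *: (Hr i k (a + b) * Hr i j a).
  have := sigma_line_line R e_gt1 a ij b jk.
  rewrite /line_phase eqxx (negPf ji) (negPf ki) (negPf kj) tpermR (tpermD ik jk).
  by rewrite subr0 [b + a]addrC.
have sWX : sigma (Hr i k (a + b) * Hr i j a) =
    Hr i k (a + b) * Hr i j a - z (- a) *: (Hr j k b * Hr i k (a + b)).
  have := sigma_line_line R e_gt1 (a + b) ik a ij.
  rewrite /line_phase eqxx (negPf ji) (negPf jk) tpermL (tpermD ij kj).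
  have -> : a + - (a + b) - 0 = - b by ring.
  (* The reflection in H_ik(a + b) turns H_ij(a) into H_kj(- b); restoring the order of j and k
     produces the minus sign. *)
  rewrite (brk2_sym R e_gt1 b jk) -scalerAl scalerA mulrN -zD scaleNr.
  by have -> : - (a + b) + b = - a by ring.
have sYW : sigma (Hr j k b * Hr i k (a + b)) =
    Hr j k b * Hr i k (a + b) + Hr i j a * Hr j k b.
  have := sigma_line_line R e_gt1 b jk (a + b) ik.
  rewrite /line_phase eqxx (negPf ij) (negPf ik) (negPf kj) tpermR (tpermD ji ki).
  by rewrite zeta_pow0 scale1r addr0 addrK.
apply: nichols_class_eq0; have := three_terms sB sZ sXY sWX sYW; apply.
by rewrite -zD subrr zeta_pow0.
Qed.

(** The reflection in H_ij(u) takes H_ij(u - c) to H_ij(u + c), as in a dihedral group, so Psi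
    shifts both parameters by c; the coefficient zeta^(m c) absorbs the scalar. *)
Lemma sigma_cycle i j a (c : 'Z_e) : i != j ->
  let U m := z (c *+ m) *: (Hr i j (a + c *+ m) * Hr i j (a + c *+ m - c)) in
  forall m, sigma (U m) = U m - U m.+1.
Proof.
move=> ij U m; rewrite sigmaZ; set u := a + c *+ m.
have -> : sigma (Hr i j u * Hr i j (u - c)) =
    Hr i j u * Hr i j (u - c) - z c *: (Hr i j (u + c) * Hr i j u).
  have := sigma_line_line R e_gt1 u ij (u - c) ij.
  have ji := ij; rewrite eq_sym in ji.
  rewrite /line_phase !eqxx (negPf ji) tpermL tpermR.
  have -> : u - c + - u - u = - (u + c) by ring.
  rewrite (brk2_sym R e_gt1 _ ij) -scalerAl scalerA mulrN -zD scaleNr.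
  by have -> : - u + (u + c) = c by ring.
rewrite scalerBr scalerA -zD /U mulrSr addrA -/u addrK.
by [].
Qed.

(** For g = gcd(e, 2 c), with c read as a natural number, 2 c (e / g) = e (2 c / g) is a multiple of
    e. *)
Lemma mulrn_order (c : 'Z_e) : c *+ (2 * (e %/ gcdn e (2 * c))) = 0 :> 'Z_e.
Proof.
rewrite -[c in c *+ _]natr_Zp -mulrnA mulnA [(c * 2)%N]mulnC muln_divA ?dvdn_gcdl //.
rewrite mulnC -muln_divA ?dvdn_gcdr //.
by apply: val_inj; rewrite /= val_Zp_nat // modnMr.
Qed.

(** Since b = a - c, the two sums consist of the terms U (2 p) and U (2 q - 1) of [sigma_cycle], and
    2 N c = 0 closes the cycle. *)
Lemma sigma_line_cycle i j a b (c : 'Z_e) N : i != j -> c = a - b -> c *+ (2 * N) = 0 ->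
  sigma (\sum_(1 <= p < N.+1) z (c *+ (2 * p)) *:
           (Hr i j (a + c *+ (2 * p)) * Hr i j (b + c *+ (2 * p))) +
         \sum_(1 <= q < N.+1) z (c *+ (2 * q - 1)) *:
           (Hr i j (b + c *+ (2 * q)) * Hr i j (a + c *+ (2 * (q - 1))))) = 0.
Proof.
move=> ij cE cN; have := @telescope_odd_even _ _ _ sD sB _
  (fun p => z (c *+ (2 * p)) *:
     (Hr i j (a + c *+ (2 * p)) * Hr i j (b + c *+ (2 * p))))
  (fun q => z (c *+ (2 * q - 1)) *:
     (Hr i j (b + c *+ (2 * q)) * Hr i j (a + c *+ (2 * (q - 1)))))
  N (sigma_cycle a c ij).
apply.
- by rewrite [c *+ (2 * N).+1]mulrS cN addr0.
- move=> p.
  by have <- : a + c *+ (2 * p) - c = b + c *+ (2 * p) by rewrite cE; ring.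
case=> [q0|q _]; first by exfalso.
have -> : b + c *+ (2 * q.+1) = a + c *+ (2 * q.+1 - 1).
  by rewrite mulnS subSS subn0 !mulrS cE; ring.
have -> : a + c *+ (2 * (q.+1 - 1)) = a + c *+ (2 * q.+1 - 1) - c.
  by rewrite mulnS !subSS !subn0 mulrS; ring.
by [].
Qed.

Lemma cls_line_cycle i j a b : i != j ->
  let N := (e %/ gcdn e (2 * (a - b : 'Z_e)%R))%N in
  cl (\sum_(1 <= p < N.+1) z ((a - b) *+ (2 * p)) *:
        (Hr i j (a + (a - b) *+ (2 * p)) * Hr i j (b + (a - b) *+ (2 * p)))) =
  - cl (\sum_(1 <= q < N.+1) z ((a - b) *+ (2 * q - 1)) *:
        (Hr i j (b + (a - b) *+ (2 * q)) *
         Hr i j (a + (a - b) *+ (2 * (q - 1))))).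
Proof.
move=> ij N; apply: nichols_class_eqN.
exact: (sigma_line_cycle ij (erefl (a - b)) (mulrn_order (a - b))).
Qed.

Let leq_pred_e s : (1 <= s <= e - 1)%N -> (0 < s < e)%N.
Proof. by rewrite subn1 -[(s <= _)%N]ltnS prednK // ltnW. Qed.

(** Write X(a) for [H_ij(a)]. Up to scalars, Psi runs through X(a) [H_i; s], [H_j; s] X(a), X(a - s)
    [H_j; s], [H_i; s] X(a - s) and back: the degree of X exchanges i and j, that of [H_j; s] lowers
    a by s, and that of [H_i; s] raises it again. *)
Lemma cls_line_coord i j a s : i != j -> (1 <= s <= e - 1)%N ->
  cl (Hr i j a * Hd i s - z (- a) *: (Hd j s * Hr i j a)
      + z (- a) *: (Hr i j (a - s%:R) * Hd j s)
      - z (- s%:R) *: (Hd i s * Hr i j (a - s%:R))) = 0.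
Proof.
move=> ij /leq_pred_e se; have ji := ij; rewrite eq_sym in ji.
have sx : sigma (Hr i j a * Hd i s) =
    Hr i j a * Hd i s + z (- a) *: (Hd j s * Hr i j a).
  have := sigma_line_coord R e_gt1 a ij i se.
  by rewrite /line_phase eqxx tpermL.
have sy : sigma (Hd j s * Hr i j a) =
    Hd j s * Hr i j a + Hr i j (a - s%:R) * Hd j s.
  have := sigma_coord_line R e_gt1 j se a ij.
  by rewrite /coord_phase eqxx (negPf ij) zeta_pow0 scale1r addr0.
have sv : sigma (Hr i j (a - s%:R) * Hd j s) = Hr i j (a - s%:R) * Hd j s +
    z (a - s%:R) *: (Hd i s * Hr i j (a - s%:R)).
  have := sigma_line_coord R e_gt1 (a - s%:R) ij j se.
  by rewrite /line_phase eqxx (negPf ji) tpermR.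
have sw : sigma (Hd i s * Hr i j (a - s%:R)) =
    Hd i s * Hr i j (a - s%:R) + z s%:R *: (Hr i j a * Hd i s).
  have := sigma_coord_line R e_gt1 i se (a - s%:R) ij.
  by rewrite /coord_phase eqxx (negPf ji) subrK subr0.
apply: nichols_class_eq0; have := four_terms sD sB sZ sx sy sv sw; apply.
  by rewrite -zD addKr.
by rewrite -zD addNr zeta_pow0.
Qed.

(** The degree of each factor fixes the other factor, so Psi only exchanges the two products;
    [cls_coordC] and [cls_line_coordC] hold for the same reason. *)
Lemma cls_lineC i j k l a b : uniq [:: i; j; k; l] ->
  cl (Hr i j a * Hr k l b) = cl (Hr k l b * Hr i j a).
Proof.
rewrite (cat_uniq [:: i; j] [:: k; l]) /= !inE !orbF !negb_or !andbT.
case/and3P=> ij /andP[/andP[ki kj] /andP[li lj]] kl.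
have ik := ki; have jk := kj; have il := li; have jl := lj.
rewrite eq_sym in ik; rewrite eq_sym in jk.
rewrite eq_sym in il; rewrite eq_sym in jl.
apply: eq_nichols_class; have := two_terms sB; apply.
  have := sigma_line_line R e_gt1 a ij b kl.
  rewrite /line_phase (negPf ki) (negPf kj) (negPf li) (negPf lj).
  by rewrite (tpermD ik jk) (tpermD il jl) zeta_pow0 scale1r subr0 addr0.
have := sigma_line_line R e_gt1 b kl a ij.
rewrite /line_phase (negPf ik) (negPf jk) (negPf il) (negPf jl).
by rewrite (tpermD ki li) (tpermD kj lj) zeta_pow0 scale1r subr0 addr0.
Qed.

Lemma cls_coordC i j s t : i != j -> (1 <= s <= e - 1)%N -> (1 <= t <= e - 1)%N ->
  cl (Hd i s * Hd j t) = cl (Hd j t * Hd i s).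
Proof.
move=> ij /leq_pred_e se /leq_pred_e te; have ji := ij; rewrite eq_sym in ji.
apply: eq_nichols_class; have := two_terms sB; apply.
  have := sigma_coord_coord R e_gt1 i se j te.
  by rewrite /coord_phase (negPf ji) zeta_pow0 scale1r.
have := sigma_coord_coord R e_gt1 j te i se.
by rewrite /coord_phase (negPf ij) zeta_pow0 scale1r.
Qed.

Lemma cls_line_coordC i j k a s : uniq [:: i; j; k] -> (1 <= s <= e - 1)%N ->
  cl (Hr i j a * Hd k s) = cl (Hd k s * Hr i j a).
Proof.
case/uniq3=> ij ik jk /leq_pred_e se; have ki := ik; have kj := jk.
rewrite eq_sym in ki; rewrite eq_sym in kj.
apply: eq_nichols_class; have := two_terms sB; apply.
  have := sigma_line_coord R e_gt1 a ij k se.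
  by rewrite /line_phase (negPf ki) (negPf kj) (tpermD ik jk) zeta_pow0 scale1r.
have := sigma_coord_line R e_gt1 k se a ij.
by rewrite /coord_phase (negPf ik) (negPf jk) zeta_pow0 scale1r subr0 addr0.
Qed.

End Relations.

(* In the second relation the number of terms is e / gcd(e, 2 (a - b)), and    *)
(* the two sums are opposite: the kernel of 1 + Psi on the span of the        *)
(* [H_ij(a + m c)] (x) [H_ij(a + (m - 1) c)], where c = a - b and m is in Z,  *)
(* is spanned by their sum over a period in m, with coefficients zeta^(m c).  *)
Theorem proposition3p2 (R : realType) (e n : nat) (he : (1 < e)%N)
    (hn : (1 <= n)%N) :
  let Hd := @brk1 R e n in
  let Hr := @brk2 R e n in
  let z := @zeta_pow R e in
  let cl := @cls R e n in
  (forall (i j k : 'I_n) (a b : 'Z_e), uniq [:: i; j; k] ->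
     cl (Hr i j a * Hr j k b - z a *: (Hr i k (a + b) * Hr i j a)
         - Hr j k b * Hr i k (a + b)) = 0) /\
  (forall (i j : 'I_n) (a b : 'Z_e), i != j ->
     let N := (e %/ gcdn e (2 * (a - b : 'Z_e)%R))%N in
     cl (\sum_(1 <= p < N.+1) z ((a - b) *+ (2 * p)) *:
           (Hr i j (a + (a - b) *+ (2 * p)) *
            Hr i j (b + (a - b) *+ (2 * p)))) =
     - cl (\sum_(1 <= q < N.+1) z ((a - b) *+ (2 * q - 1)) *:
           (Hr i j (b + (a - b) *+ (2 * q)) *
            Hr i j (a + (a - b) *+ (2 * (q - 1)))))) /\
  (forall (i j : 'I_n) (a : 'Z_e) (s : nat), i != j -> (1 <= s <= e - 1)%N ->
     cl (Hr i j a * Hd i s - z (- a) *: (Hd j s * Hr i j a)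
         + z (- a) *: (Hr i j (a - s%:R) * Hd j s)
         - z (- s%:R) *: (Hd i s * Hr i j (a - s%:R))) = 0) /\
  (forall (i j k l : 'I_n) (a b : 'Z_e), uniq [:: i; j; k; l] ->
     cl (Hr i j a * Hr k l b) = cl (Hr k l b * Hr i j a)) /\
  (forall (i j : 'I_n) (s t : nat), i != j ->
     (1 <= s <= e - 1)%N -> (1 <= t <= e - 1)%N ->
     cl (Hd i s * Hd j t) = cl (Hd j t * Hd i s)) /\
  (forall (i j k : 'I_n) (a : 'Z_e) (s : nat), uniq [:: i; j; k] ->
     (1 <= s <= e - 1)%N ->
     cl (Hr i j a * Hd k s) = cl (Hd k s * Hr i j a)).
Proof.
move=> Hd Hr z cl; split; first by move=> *; apply: cls_line_path.
split; first by move=> *; apply: cls_line_cycle.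
split; first by move=> *; apply: cls_line_coord.
split; first by move=> *; apply: cls_lineC.
split; first by move=> *; apply: cls_coordC.
by move=> *; apply: cls_line_coordC.
Qed.
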